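(* Let $\mathcal{A}\subset\mathbb{R}^d$ be a finite set, $\mathcal{M}=\operatorname{conv}(\mathcal{A})$, with the elements of $\mathcal{A}$ extreme points of $\mathcal{M}$. Let $f:\mathbb{R}^d\to\mathbb{R}$ be convex and differentiable with finite away curvature constant $C_f^A>0$ and strictly positive (finite) geometric strong convexity constant $\mu_f^A$, and let $h(\boldsymbol{x})=f(\boldsymbol{x})-\min_{\mathcal{M}}f$. Let $(\boldsymbol{x}_t)$ be the iterates of the Randomized Away-steps Frank-Wolfe algorithm (RAFW) with subsampling parameter $1\le p\le|\mathcal{A}|$, started at $\boldsymbol{x}_0=\sum_{\boldsymbol{v}\in\mathcal{A}}\alpha^{(0)}_{\boldsymbol{v}}\boldsymbol{v}$ with initial active set $\mathcal{S}_0$, $s=|\mathcal{S}_0|$. Then for every $T\ge 0$, after running the iterations $t=0,1,\dots,T$, $$\mathbb{E}\big[h(\boldsymbol{x}_{T+1})\big]\;\le\;\big(1-\eta^2\rho_f\big)^{\max\{0,\lfloor (T-s)/2\rfloor\}}\,h(\boldsymbol{x}_0),\qquad \rho_f=\frac{\mu_f^A}{4C_f^A},\quad \eta=\frac{p}{|\mathcal{A}|}.$$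
   Context: **RAFW algorithm.** $\mathcal{A}$ is a finite set of atoms, $\mathcal{M}=\operatorname{conv}(\mathcal{A})$. The algorithm maintains $\boldsymbol{x}_t=\sum_{\boldsymbol{v}\in\mathcal{A}}\alpha^{(t)}_{\boldsymbol{v}}\boldsymbol{v}$ with $\alpha^{(t)}_{\boldsymbol{v}}\ge0$, $\sum_{\boldsymbol{v}}\alpha^{(t)}_{\boldsymbol{v}}=1$, and active set $\mathcal{S}_t=\{\boldsymbol{v}\in\mathcal{A}:\alpha_{\boldsymbol{v}}^{(t)}>0\}$. At each iteration $t=0,1,\dots$: 1. Sample $\mathcal{A}_t$, a subset of $\mathcal{A}\setminus\mathcal{S}_t$ of size $\min\{p,|\mathcal{A}\setminus\mathcal{S}_t|\}$, uniformly at random among all such subsets, with fresh randomness at each iteration. Let $\mathcal{V}_t=\mathcal{S}_t\cup\mathcal{A}_t$. 2. Let $\boldsymbol{s}_t\in\arg\min_{\boldsymbol{v}\in\mathcal{V}_t}\langle\nabla f(\boldsymbol{x}_t),\boldsymbol{v}\rangle$ and $\boldsymbol{d}_t^{FW}=\boldsymbol{s}_t-\boldsymbol{x}_t$. 3. Let $\boldsymbol{v}_t\in\arg\max_{\boldsymbol{v}\in\mathcal{S}_t}\langle\nabla f(\boldsymbol{x}_t),\boldsymbol{v}\rangle$ and $\boldsymbol{d}_t^{A}=\boldsymbol{x}_t-\boldsymbol{v}_t$. 4. If $\langle-\nabla f(\boldsymbol{x}_t),\boldsymbol{d}_t^{FW}\rangle\ge\langle-\nabla f(\boldsymbol{x}_t),\boldsymbol{d}_t^{A}\rangle$,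 take a FW step: $\boldsymbol{d}_t=\boldsymbol{d}_t^{FW}$, $\gamma_{\max}=1$. Otherwise take an away step: $\boldsymbol{d}_t=\boldsymbol{d}_t^A$, $\gamma_{\max}=\alpha^{(t)}_{\boldsymbol{v}_t}/(1-\alpha^{(t)}_{\boldsymbol{v}_t})$ (an away step never occurs with $\alpha^{(t)}_{\boldsymbol{v}_t}=1$). 5. Let $\gamma_t\in\arg\min_{\gamma\in[0,\gamma_{\max}]}f(\boldsymbol{x}_t+\gamma\boldsymbol{d}_t)$ and $\boldsymbol{x}_{t+1}=\boldsymbol{x}_t+\gamma_t\boldsymbol{d}_t$. 6. Update the weights. FW step: $\alpha^{(t+1)}_{\boldsymbol{v}}=(1-\gamma_t)\alpha^{(t)}_{\boldsymbol{v}}$ for $\boldsymbol{v}\ne\boldsymbol{s}_t$, and $\alpha^{(t+1)}_{\boldsymbol{s}_t}=(1-\gamma_t)\alpha^{(t)}_{\boldsymbol{s}_t}+\gamma_t$. Away step: $\alpha^{(t+1)}_{\boldsymbol{v}}=(1+\gamma_t)\alpha^{(t)}_{\boldsymbol{v}}$ for $\boldsymbol{v}\neq\boldsymbol{v}_t$, and $\alpha^{(t+1)}_{\boldsymbol{v}_t}=(1+\gamma_t)\alpha^{(t)}_{\boldsymbol{v}_t}-\gamma_t$ (if $\gamma_t=\gamma_{\max}$, $\boldsymbol{v}_t$ leaves the active set). Set $\mathcal{S}_{t+1}=\{\boldsymbol{v}:\alpha^{(t+1)}_{\boldsymbol{v}}>0\}$. Ties in all argmin/argmax are broken by fixed deterministic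 rules; in particular $\boldsymbol{v}_t$ and the line search along $\boldsymbol{d}_t^A$ do not depend on $\mathcal{A}_t$. $\mathbb{E}$ is the full expectation over all the samplings. **Away curvature constant.** $$C_f^A=\sup_{\substack{\boldsymbol{x},\boldsymbol{s},\boldsymbol{v}\in\mathcal{M},\ \gamma\in(0,1]\\ \boldsymbol{y}=\boldsymbol{x}+\gamma(\boldsymbol{s}-\boldsymbol{v})}}\frac{2}{\gamma^2}\big(f(\boldsymbol{y})-f(\boldsymbol{x})-\gamma\langle\nabla f(\boldsymbol{x}),\boldsymbol{s}-\boldsymbol{v}\rangle\big)$$ (here $\boldsymbol{y}$ may lie outside $\mathcal{M}$). **Geometric strong convexity constant.** $$\mu_f^A=\inf_{\boldsymbol{x}\in\mathcal{M}}\ \inf_{\substack{\boldsymbol{z}\in\mathcal{M}\\ \langle\nabla f(\boldsymbol{x}),\boldsymbol{z}-\boldsymbol{x}\rangle<0}}\frac{2}{\gamma^A(\boldsymbol{x},\boldsymbol{z})^2}\big(f(\boldsymbol{z})-f(\boldsymbol{x})-\langle\nabla f(\boldsymbol{x}),\boldsymbol{z}-\boldsymbol{x}\rangle\big),\qquad \gamma^A(\boldsymbol{x},\boldsymbol{z})=\frac{\langle-\nabla f(\boldsymbol{x}),\boldsymbol{z}-\boldsymbol{x}\rangle}{\langle-\nabla f(\boldsymbol{x}),\boldsymbol{s}_f(\boldsymbol{x})-\boldsymbol{v}_f(\boldsymbol{x})\rangle},$$ where $\boldsymbol{s}_f(\boldsymbol{x})\in\arg\min_{\boldsymbol{v}\in\mathcal{A}}\langle\nabla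 f(\boldsymbol{x}),\boldsymbol{v}\rangle$, and $\boldsymbol{v}_f(\boldsymbol{x})$ is defined as follows: let $\mathcal{S}_{\boldsymbol{x}}$ be the family of all $\mathcal{S}\subseteq\mathcal{A}$ such that $\boldsymbol{x}$ is a convex combination of the elements of $\mathcal{S}$ with all weights strictly positive; for $\mathcal{S}\in\mathcal{S}_{\boldsymbol{x}}$ let $\boldsymbol{v}_{\mathcal{S}}\in\arg\max_{\boldsymbol{v}\in\mathcal{S}}\langle\nabla f(\boldsymbol{x}),\boldsymbol{v}\rangle$; then $\boldsymbol{v}_f(\boldsymbol{x})\in\arg\min\{\langle\nabla f(\boldsymbol{x}),\boldsymbol{v}\rangle:\boldsymbol{v}=\boldsymbol{v}_{\mathcal{S}},\ \mathcal{S}\in\mathcal{S}_{\boldsymbol{x}}\}$. *)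

(* Defs.v *)
From HB Require Import structures.
From mathcomp Require Import all_boot all_order all_algebra finmap.
From mathcomp Require Import all_classical all_reals all_analysis.

Set Implicit Arguments.
Unset Strict Implicit.
Unset Printing Implicit Defensive.

Import Order.TTheory GRing.Theory Num.Theory.
Import numFieldNormedType.Exports.

Local Open Scope classical_set_scope.
Local Open Scope ring_scope.

Section Geometry.
Context {R : realType} {d : nat}.
Implicit Types (A : {fset 'rV[R]_d}) (M : set 'rV[R]_d) (f : 'rV[R]_d -> R).

Definition dot (u v : 'rV[R]_d) : R := \sum_i u 0 i * v 0 i.

Definition grad f (x : 'rV[R]_d) : 'rV[R]_d :=
  \row_i 'D_(delta_mx 0 i) f x.

Definition is_weight A (alpha : {ffun A -> R}) : Prop :=
  (forall v, 0 <= alpha v) /\ \sum_v alpha v = 1.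

Definition combination A (alpha : {ffun A -> R}) : 'rV[R]_d :=
  \sum_v alpha v *: val v.

Definition support_set A (alpha : {ffun A -> R}) : {set A} :=
  [set v | 0 < alpha v]%SET.

Definition conv_hull A : set 'rV[R]_d :=
  [set x | exists2 alpha : {ffun A -> R}, is_weight alpha
                                        & x = combination alpha].

Definition extreme_point M (x : 'rV[R]_d) : Prop :=
  M x /\ forall y z (t : R), M y -> M z -> 0 < t < 1 ->
    x = t *: y + (1 - t) *: z -> y = x /\ z = x.

(* The default value 0 is only used when there is no minimum. *)
Definition min_on M f : R :=
  xget 0 [set m | (exists2 x, M x & f x = m) /\ forall y, M y -> m <= f y].

Definition primal_gap f A (x : 'rV[R]_d) : R := f x - min_on (conv_hull A) f.

Definition is_argmin A (g : 'rV[R]_d) (V : {set A}) (s : A) : Prop :=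
  s \in V /\ forall v, v \in V -> dot g (val s) <= dot g (val v).

Definition is_argmax A (g : 'rV[R]_d) (V : {set A}) (s : A) : Prop :=
  s \in V /\ forall v, v \in V -> dot g (val v) <= dot g (val s).

Definition away_curvature f A : \bar R :=
  ereal_sup [set e | exists (x s v : 'rV[R]_d) (gamma : R),
    [/\ conv_hull A x, conv_hull A s, conv_hull A v, 0 < gamma <= 1 &
        let y := x + gamma *: (s - v) in
        e = (2 / gamma ^+ 2 *
              (f y - f x - gamma * dot (grad f x) (s - v)))%:E]].

Definition proper_support A (x : 'rV[R]_d) (S : {set A}) : Prop :=
  exists alpha : {ffun A -> R},
    [/\ is_weight alpha, x = combination alpha & support_set alpha = S].

Definition away_candidate f A (x : 'rV[R]_d) (v : A) : Prop :=
  exists2 S : {set A}, proper_support x S & is_argmax (grad f x) S v.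

Definition is_away_vertex f A (x : 'rV[R]_d) (v : A) : Prop :=
  away_candidate f x v /\
  forall u : A, away_candidate f x u ->
    dot (grad f x) (val v) <= dot (grad f x) (val u).

Definition away_step_size f (x z s v : 'rV[R]_d) : R :=
  dot (- grad f x) (z - x) / dot (- grad f x) (s - v).

(* The value of [away_step_size] does not depend on which minimizers
   [s] = s_f(x) and [v] = v_f(x) are selected, so quantifying over all of them
   agrees with fixing a selection. *)
Definition geometric_strong_convexity f A : \bar R :=
  ereal_inf [set e | exists (x z : 'rV[R]_d) (s v : A),
    [/\ conv_hull A x, conv_hull A z /\ dot (grad f x) (z - x) < 0,
        is_argmin (grad f x) [set: A]%SET s, is_away_vertex f x v &
        e = (2 / away_step_size f x z (val s) (val v) ^+ 2 *
              (f z - f x - dot (grad f x) (z - x)))%:E]].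

End Geometry.

Section RAFW.
Context {R : realType} {d : nat}.
Variable A : {fset 'rV[R]_d}.
Implicit Types (f : 'rV[R]_d -> R) (p t : nat).

Record rafw_state := RafwState {
  iterate : 'rV[R]_d;
  weight : {ffun A -> R} }.
Implicit Type st : rafw_state.

Definition active st : {set A} := support_set (weight st).

Definition init_state (alpha : {ffun A -> R}) : rafw_state :=
  RafwState (combination alpha) alpha.

(* Deterministic tie-breaking: each selection is a function of the current
   state and of the data of the optimization problem being solved.  Only
   [fw_atom] sees the sampled atoms, through the candidate set.
   [line_search st dir gmax] is the step size on [0, gmax] along [dir]. *)
Record rafw_rules := RafwRules {
  fw_atom : rafw_state -> {set A} -> A;
  away_atom : rafw_state -> A;
  line_search : rafw_state -> 'rV[R]_d -> R -> R }.

Definition valid_rules f (rules : rafw_rules) : Prop :=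
  [/\ forall st (V : {set A}), V != finset.set0 ->
        is_argmin (grad f (iterate st)) V (fw_atom rules st V),
      forall st, active st != finset.set0 ->
        is_argmax (grad f (iterate st)) (active st) (away_atom rules st) &
      forall st (dir : 'rV[R]_d) (gmax : R), 0 <= gmax ->
        let gamma := line_search rules st dir gmax in
        0 <= gamma <= gmax /\
        forall gamma', 0 <= gamma' <= gmax ->
          f (iterate st + gamma *: dir) <= f (iterate st + gamma' *: dir)].

Definition rafw_step f (rules : rafw_rules) st (At : {set A}) : rafw_state :=
  let x := iterate st in
  let alpha := weight st in
  let g := grad f x in
  let s := fw_atom rules st (active st :|: At)%SET in
  let v := away_atom rules st in
  let dFW := val s - x in
  let dA := x - val v in
  if dot (- g) dFW >= dot (- g) dA then
    let gamma := line_search rules st dFW 1 in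
    RafwState (x + gamma *: dFW)
      [ffun u => if u == s then (1 - gamma) * alpha u + gamma
                 else (1 - gamma) * alpha u]
  else
    let gamma := line_search rules st dA (alpha v / (1 - alpha v)) in
    RafwState (x + gamma *: dA)
      [ffun u => if u == v then (1 + gamma) * alpha u - gamma
                 else (1 + gamma) * alpha u].

(* The state before iteration [t], when iteration [i] samples [B i]; it only
   depends on [B i] for [i < t]. *)
Fixpoint rafw f (rules : rafw_rules) (alpha0 : {ffun A -> R})
    (B : nat -> {set A}) (t : nat) : rafw_state :=
  if t is t'.+1 then rafw_step f rules (rafw f rules alpha0 B t') (B t')
  else init_state alpha0.

Definition samples p (S : {set A}) : {set {set A}} :=
  [set B : {set A} | (B \subset ~: S) && (#|B| == minn p #|~: S|)]%SET.

(* Conditionally on the atoms sampled before iteration [t] (which determine the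
   state), the set sampled at iteration [t] is uniform on [samples]. *)
Definition uniform_sampling f (rules : rafw_rules) (alpha0 : {ffun A -> R}) p
    (disp : measure_display) (Omega : measurableType disp)
    (P : probability Omega R) (As : nat -> Omega -> {set A}) : Prop :=
  (forall t (B : {set A}), measurable [set w | As t w = B]) /\
  forall t (B : nat -> {set A}),
    let adm := samples p (active (rafw f rules alpha0 B t)) in
    P [set w | forall i, (i <= t)%N -> As i w = B i] =
    (P [set w | forall i, (i < t)%N -> As i w = B i] *
      ((B t \in adm)%:R / #|adm|%:R)%:E)%E.

End RAFW.

(* Main.v *)
(* Call an away step a drop step when its line search reaches the end of the
   interval.  Convexity bounds the primal gap h by D^2 / (2 mu), where D is the
   pairwise gap between the full linear minimizer s_f(x) and the away atom.
   When s_f(x) is among the candidates and the step is not a drop step, the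
   curvature inequality along the direction taken (whose slope is at least
   D / 2) gives h' <= (1 - rho) h; the case where that inequality is optimized
   at step size 1 uses mu <= C, which is read off at a vertex.

   The probability that s_f(x) is a candidate is at least eta.  Whether the step
   is a drop step depends on the sample, but if some sample containing s_f(x)
   leads to a drop step, then every sample does.  Hence, conditionally on the
   step not being a drop step, the expected contraction factor is at most
   1 - eta rho <= 1 - eta^2 rho.  A drop step removes an atom and any other step
   adds at most one, so inducting backwards over the remaining iterations, with
   an exponent depending on the current number of active atoms, yields the
   bound. *)

Require Import Defs.
From HB Require Import structures.
From mathcomp Require Import all_boot all_order all_algebra finmap.
From mathcomp Require Import all_classical all_reals all_analysis.
From mathcomp Require Import ring lra.

Set Implicit Arguments.
Unset Strict Implicit.
Unset Printing Implicit Defensive.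

Import Order.TTheory GRing.Theory Num.Theory.
Import numFieldNormedType.Exports.

Local Open Scope classical_set_scope.
Local Open Scope ring_scope.

(** * Dot product, gradient and first-order convexity *)

Section Dot.
Context {R : realType} {d : nat}.
Implicit Types (u v w x : 'rV[R]_d) (a : R) (f : 'rV[R]_d -> R).

Lemma dotDr u v w : dot u (v + w) = dot u v + dot u w.
Proof. by rewrite /dot -big_split; apply: eq_bigr => i _; rewrite mxE mulrDr. Qed.

Lemma dotZr a u v : dot u (a *: v) = a * dot u v.
Proof.
by rewrite /dot mulr_sumr; apply: eq_bigr => i _; rewrite mxE mulrCA.
Qed.

Lemma dotNr u v : dot u (- v) = - dot u v.
Proof. by rewrite -scaleN1r dotZr mulN1r. Qed.

Lemma dotBr u v w : dot u (v - w) = dot u v - dot u w.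
Proof. by rewrite dotDr dotNr. Qed.

Lemma dotNl u v : dot (- u) v = - dot u v.
Proof.
by rewrite /dot -sumrN; apply: eq_bigr => i _; rewrite mxE mulNr.
Qed.

Lemma dot_sumr (I : finType) u (F : I -> 'rV[R]_d) :
  dot u (\sum_i F i) = \sum_i dot u (F i).
Proof.
apply: (big_morph _ (dotDr u)).
by rewrite /dot big1 // => i _; rewrite mxE mulr0.
Qed.

Lemma dot_grad f x u : differentiable f x -> dot (grad f x) u = 'D_u f x.
Proof.
move=> df; rewrite deriveE// {2}(row_sum_delta u) linear_sum.
by apply: eq_bigr => i _; rewrite linearZ mxE deriveE// mulrC.
Qed.

Lemma convex_segment f x u (t : R) :
  convex_function (setT : set (convex_lmodType 'rV[R]_d)) f ->
  0 <= t <= 1 -> f (x + t *: (u - x)) <= f x + t * (f u - f x).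
Proof.
move=> cf /andP[t0 t1].
have h : f (t *: u + (1 - t) *: x) <= t * f u + (1 - t) * f x.
  by apply: (cf (Itv01 t0 t1)); rewrite inE.
have -> : x + t *: (u - x) = t *: u + (1 - t) *: x.
  by rewrite scalerBr scalerBl scale1r addrCA.
apply: (le_trans h); lra.
Qed.

(** Convexity bounds the difference quotient towards [u] by [f u - f x] for step sizes in (0, 1];
    the bound passes to the limit from the right. *)
Lemma convex_ge_tangent f x u :
  convex_function (setT : set (convex_lmodType 'rV[R]_d)) f ->
  differentiable f x -> f x + dot (grad f x) (u - x) <= f u.
Proof.
move=> cf df; rewrite dot_grad// -lerBrDl.
have /cvg_ex[l hl] :
    cvg ((fun h => h^-1 *: ((f \o shift x) (h *: (u - x)) - f x)) @ 0^').
  exact/diff_derivable.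
have -> : 'D_(u - x) f x = l by apply: cvg_lim.
have hr : (fun h => h^-1 *: ((f \o shift x) (h *: (u - x)) - f x)) @ 0^'+ --> l.
  exact: cvg_dnbhs_at_right hl.
apply: (closed_cvg (fun y => y <= f u - f x) _ _ _ hr); first exact: closed_le.
near=> t.
have t0 : 0 < t by near: t; exact: nbhs_right_gt.
have t1 : t <= 1 by near: t; exact: nbhs_right_le.
have := @convex_segment f x u t cf.
rewrite (ltW t0) t1 => /(_ isT) h.
rewrite /= -[X in X <= _]/(t^-1 * _) ler_pdivrMl//.
by rewrite lerBlDl (addrC (t *: _)).
Unshelve. all: by end_near. Qed.

End Dot.

(** * Convex hull of the atoms: vertices, existence of a minimum, linear bounds *)

Section ConvHull.
Context {R : realType} {d : nat}.
Variable A : {fset 'rV[R]_d}.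
Implicit Types (g x : 'rV[R]_d) (f : 'rV[R]_d -> R) (alpha : {ffun A -> R}).

Definition vertex_weight (v : A) : {ffun A -> R} := [ffun u => (u == v)%:R].

Lemma is_weight_vertex v : is_weight (vertex_weight v).
Proof.
split=> [u|]; first by rewrite ffunE ler0n.
rewrite (bigD1 v)//= ffunE eqxx big1 ?addr0// => u /negPf uv.
by rewrite ffunE uv.
Qed.

Lemma combination_vertex_weight v : combination (vertex_weight v) = val v.
Proof.
rewrite /combination (bigD1 v)//= ffunE eqxx scale1r big1 ?addr0// => u /negPf uv.
by rewrite ffunE uv scale0r.
Qed.

Lemma support_vertex_weight v : support_set (vertex_weight v) = [set v]%SET.
Proof. by apply/setP => u; rewrite !finset.inE ffunE; case: eqP; rewrite ?ltr01 ?ltxx. Qed.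

Lemma conv_hull_val (v : A) : conv_hull A (val v).
Proof.
exists (vertex_weight v); first exact: is_weight_vertex.
by rewrite combination_vertex_weight.
Qed.

Lemma is_weight_inh alpha : is_weight alpha -> exists v : A, 0 < alpha v.
Proof.
move=> [a0 a1]; apply: contrapT => /forallNP h.
have : \sum_v alpha v = 0.
  by apply: big1 => v _; apply/eqP; rewrite eq_le a0 andbT leNgt; apply/negP/h.
by rewrite a1 => /eqP; rewrite oner_eq0.
Qed.

(** The hull is a continuous image of the compact simplex of weights, so the minimum is attained and
    [min_on] does not take its default value. *)
Lemma conv_hull_min f : (exists x, conv_hull A x) ->
  (forall x, {for x, continuous f}) ->
  exists x, [/\ conv_hull A x, f x = min_on (conv_hull A) f &
    forall y, conv_hull A y -> f x <= f y].
Proof.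
move=> [_ [alpha0 w0 _]] cf.
pose n := #|{: A}|.
pose ff (r : 'rV[R]_n) : {ffun A -> R} := [ffun v => r 0 (enum_rank v)].
pose simp := [set r : 'rV[R]_n | is_weight (ff r)].
have cff (v : A) : continuous (fun r : 'rV[R]_n => ff r v).
  have -> : (fun r => ff r v) = (fun r => r 0 (enum_rank v)).
    by apply/funext => r; rewrite ffunE.
  exact: coord_continuous.
have csum : continuous (fun r : 'rV[R]_n => \sum_v ff r v).
  apply: (continuous_big (U := R)); first exact: (@add_continuous R^o).
  by move=> v _; exact: cff.
have ccomb : continuous (fun r : 'rV[R]_n => combination (ff r)).
  apply: (continuous_big (U := 'rV[R]_d)); first exact: (@add_continuous 'rV[R]_d).
  by move=> v _ r; apply: cvgZr_tmp; [exact: nbhs_filter|exact: cff].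
have csimp : compact simp.
  have -> : simp = [set r : 'rV[R]_n | forall i, `[0 : R, 1]%classic (r 0 i)] 
      `&` [set r | \sum_v ff r v = 1].
    apply/seteqP; split=> r /= [r0 r1]; split=> //.
      move=> i; rewrite in_itv/=; have := r0 (enum_val i).
      rewrite ffunE enum_valK => -> /=; rewrite -r1 (bigD1 (enum_val i))//=.
      by rewrite ffunE enum_valK lerDl sumr_ge0.
    by move=> v; rewrite ffunE; have := r0 (enum_rank v); rewrite in_itv => /andP[].
  apply: compact_closedI.
    apply: (@rV_compact R^o n (fun=> `[0 : R, 1]%classic)) => i; exact: segment_compact.
  apply: (@closed_comp _ _ _ [set (1:R)]); last exact: closed_eq.
  by move=> r _; exact: csum.
have ffK (a : {ffun A -> R}) : ff (\row_i a (enum_val i)) = a.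
  by apply/ffunP => v; rewrite ffunE mxE enum_rankK.
have s0 : simp !=set0.
  by exists (\row_i alpha0 (enum_val i)); rewrite /simp/= ffK.
have [|r simpr rmin] :=
  @compact_EVT_min _ R (fun r => f (combination (ff r))) simp s0 csimp.
  apply: continuous_subspaceT => r.
  apply: (@continuous_comp _ _ _ (fun r => combination (ff r)) f).
    exact: ccomb.
  exact: cf.
have Mr : conv_hull A (combination (ff r)).
  by exists (ff r) => //; move: simpr; rewrite inE.
have Mmin y : conv_hull A y -> f (combination (ff r)) <= f y.
  by move=> [a wa ->]; rewrite -[a]ffK; apply: rmin; rewrite inE /simp /= ffK.
exists (combination (ff r)); split=> //; rewrite /min_on.
have [|[y My <-] ymin] := @xgetPex R 0 [set m | (exists2 x, conv_hull A x & f x = m) /\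
    forall y, conv_hull A y -> m <= f y].
  by exists (f (combination (ff r))); split=> //; exists (combination (ff r)).
by apply/eqP; rewrite eq_le ymin// Mmin.
Qed.

Lemma dot_combination g alpha :
  dot g (combination alpha) = \sum_v alpha v * dot g (val v).
Proof. by rewrite dot_sumr; apply: eq_bigr => v _; rewrite dotZr. Qed.

Lemma dot_combination_le g alpha b : is_weight alpha ->
  (forall v, 0 < alpha v -> dot g (val v) <= b) -> dot g (combination alpha) <= b.
Proof.
move=> [a0 a1] h; rewrite dot_combination -[leRHS]mul1r -a1 mulr_suml.
apply: ler_sum => v _; have := a0 v; rewrite le_eqVlt => /predU1P[<-|av].
  by rewrite !mul0r.
by rewrite ler_pM2l// h.
Qed.

Lemma dot_combination_ge g alpha b : is_weight alpha ->
  (forall v, 0 < alpha v -> b <= dot g (val v)) -> b <= dot g (combination alpha).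
Proof.
move=> wa h; rewrite -lerN2 -dotNl; apply: dot_combination_le => // v av.
by rewrite dotNl lerN2 h.
Qed.

End ConvHull.

Lemma finite_argmin {R : realType} (T : finType) (P : T -> Prop) (F : T -> R) :
  (exists t, P t) -> exists2 t, P t & forall u, P u -> F t <= F u.
Proof.
move=> [t0 /asboolT Pt0].
have [t /asboolP Pt tmin] :=
  @Order.TotalTheory.arg_minP _ R T t0 (fun t => `[< P t >]) F Pt0.
by exists t => // u /asboolT; exact: tmin.
Qed.

(* The optimal value of the quadratic model at [gamma = min(1, g / C)]. *)
Lemma quadratic_descent {R : realType} (C mu g D h fx y : R) :
  0 < C -> 0 < mu -> mu <= C -> 0 <= D -> D <= 2 * g -> 0 < h -> h <= g ->
  2 * mu * h <= D ^+ 2 ->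
  (forall gamma, 0 < gamma <= 1 -> y <= fx - gamma * g + gamma ^+ 2 * C / 2) ->
  y <= fx - mu / (4 * C) * h.
Proof.
move=> C0 mu0 muC D0 Dg h0 hg hD yle.
have g0 : 0 < g by exact: lt_le_trans hg.
have [gC|Cg] := leP g C; last first.
  (* For [C < g] the step size 1 already decreases the value by [g / 2], hence by [h / 2], while
     [mu <= C] bounds the target decrease by [h / 4]. *)
  have := yle 1; rewrite ltr01 lexx => /(_ isT) y1.
  have : mu / (4 * C) * h <= h / 4.
    by rewrite mulrAC ler_pdivrMr ?mulr_gt0//; nra.
  by move=> ?; lra.
(* The decrease is now [g ^+ 2 / (2 * C)]; the claim follows from
   [2 * mu * h <= D ^+ 2 <= 4 * g ^+ 2]. *)
have := yle (g / C); rewrite divr_gt0// ler_pdivrMr// mul1r gC => /(_ isT) yg.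
apply: (le_trans yg).
have -> : fx - g / C * g + (g / C) ^+ 2 * C / 2 = fx - g ^+ 2 / (2 * C).
  by field; rewrite gt_eqF.
rewrite lerD2l lerN2 mulrAC ler_pdivrMr ?mulr_gt0//.
have -> : g ^+ 2 / (2 * C) * (4 * C) = 2 * g ^+ 2 by field; rewrite gt_eqF.
by nra.
Qed.

(** * Bounds on the primal gap from curvature and strong convexity *)

Section Geometry.
Context {R : realType} {d : nat}.
Variables (A : {fset 'rV[R]_d}) (f : 'rV[R]_d -> R) (C mu : R).
Hypothesis convf : convex_function (setT : set (convex_lmodType 'rV[R]_d)) f.
Hypothesis diff_f : forall x, differentiable f x.
Hypothesis curvf : away_curvature f A = C%:E.
Hypothesis geomf : geometric_strong_convexity f A = mu%:E.
Hypothesis mu_gt0 : 0 < mu.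

Lemma curvature_le x s v (gamma : R) :
  conv_hull A x -> conv_hull A s -> conv_hull A v -> 0 < gamma <= 1 ->
  f (x + gamma *: (s - v)) <=
    f x + gamma * dot (grad f x) (s - v) + gamma ^+ 2 * C / 2.
Proof.
move=> Mx Ms Mv g01.
have := ereal_sup_ubound (S := [set e | exists (x s v : 'rV[R]_d) (gamma : R),
    [/\ conv_hull A x, conv_hull A s, conv_hull A v, 0 < gamma <= 1 &
        let y := x + gamma *: (s - v) in
        e = (2 / gamma ^+ 2 *
              (f y - f x - gamma * dot (grad f x) (s - v)))%:E]]).
rewrite -/(away_curvature f A) curvf => /(_ _ (ex_intro _ x (ex_intro _ s
  (ex_intro _ v (ex_intro _ gamma (And5 Mx Ms Mv g01 erefl)))))).
have g2 : 0 < gamma ^+ 2 by rewrite exprn_gt0//; case/andP: g01.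
rewrite lee_fin mulrAC ler_pdivrMr// => h; lra.
Qed.

Lemma geometric_strong_convexity_le x z (s v : A) :
  conv_hull A x -> conv_hull A z -> dot (grad f x) (z - x) < 0 ->
  is_argmin (grad f x) [set: A]%SET s -> is_away_vertex f x v ->
  mu <= 2 / away_step_size f x z (val s) (val v) ^+ 2 *
              (f z - f x - dot (grad f x) (z - x)).
Proof.
move=> Mx Mz dn sm vm.
rewrite -lee_fin -geomf; apply: ereal_inf_lbound.
by exists x, z, s, v; split.
Qed.

Lemma exists_argmin (g : 'rV[R]_d) (V : {set A}) : (V != finset.set0) ->
  exists s, is_argmin g V s.
Proof.
move=> /set0Pn /(finite_argmin (fun v : A => dot g (val v)))[s sV smin].
by exists s.
Qed.

Lemma exists_argmax (g : 'rV[R]_d) (V : {set A}) : (V != finset.set0) ->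
  exists s, is_argmax g V s.
Proof.
move=> /set0Pn /(finite_argmin (fun v : A => - dot g (val v)))[s sV smin].
by exists s; split=> // v /smin; rewrite lerN2.
Qed.

Lemma argmin_dot_le g (s : A) x : is_argmin g [set: A]%SET s -> conv_hull A x ->
  dot g (val s) <= dot g x.
Proof.
move=> [_ smin] [alpha wa ->]; apply: dot_combination_ge => // v _.
exact/smin/finset.in_setT.
Qed.

Lemma away_candidate_ge x (u : A) : away_candidate f x u ->
  dot (grad f x) x <= dot (grad f x) (val u).
Proof.
move=> [S [alpha [wa -> <-]] [_ umax]].
apply: dot_combination_le => // v av; apply: umax.
by rewrite finset.inE.
Qed.

Lemma exists_away_vertex x : conv_hull A x -> exists v : A, is_away_vertex f x v.
Proof.
move=> [alpha wa xE].
have [|v cv vmin] := @finite_argmin R A (away_candidate f x)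
    (fun v : A => dot (grad f x) (val v)); last by exists v.
have [|v vm] := exists_argmax (grad f x) (V := support_set alpha).
  by have [u au] := is_weight_inh wa; apply/set0Pn; exists u; rewrite finset.inE.
by exists v, (support_set alpha) => //; exists alpha.
Qed.

Lemma conv_hull_argmin : (exists x, conv_hull A x) ->
  exists z, [/\ conv_hull A z, f z = min_on (conv_hull A) f &
    forall y, conv_hull A y -> f z <= f y].
Proof. by move=> M0; apply: conv_hull_min => // x; exact: differentiable_continuous. Qed.

Lemma primal_gap_ge0 x : conv_hull A x -> 0 <= primal_gap f A x.
Proof.
move=> Mx; rewrite subr_ge0.
by have [z [_ <- zmin]] := conv_hull_argmin (ex_intro _ x Mx); exact: zmin.
Qed.

(** The tangent at [x] bounds [f] from below at a minimizer over the hull, and the linear part is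
    smallest at [s]. *)
Lemma primal_gap_le_dot x (s : A) : conv_hull A x ->
  is_argmin (grad f x) [set: A]%SET s ->
  primal_gap f A x <= dot (grad f x) (x - val s).
Proof.
move=> Mx sm; have [z [Mz fz _]] := conv_hull_argmin (ex_intro _ x Mx).
have := convex_ge_tangent z convf (diff_f x).
have := argmin_dot_le sm Mz.
by rewrite /primal_gap -fz !dotBr; lra.
Qed.

(* Maximizing [gamma * D - mu / 2 * gamma ^ 2] over [gamma]. *)
Lemma primal_gap_le_pairwise (alpha : {ffun A -> R}) (s v : A) :
  let x := combination alpha in
  is_weight alpha -> 0 < primal_gap f A x ->
  is_argmin (grad f x) [set: A]%SET s ->
  is_argmax (grad f x) (support_set alpha) v ->
  2 * mu * primal_gap f A x <= (dot (grad f x) (val v - val s)) ^+ 2.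
Proof.
move=> x wa gap0 sm vm; have Mx : conv_hull A x by exists alpha.
have [z [Mz fz _]] := conv_hull_argmin (ex_intro _ x Mx).
have [u um] := exists_away_vertex Mx.
(* The away vertex [u] of the definition minimizes over all supports of [x], one of which is that of
   [alpha]. *)
have uv : dot (grad f x) (val u) <= dot (grad f x) (val v).
  by apply: um.2; exists (support_set alpha) => //; exists alpha.
have xu := away_candidate_ge um.1.
have sz := argmin_dot_le sm Mz.
have tz := convex_ge_tangent z convf (diff_f x).
move: gap0; rewrite /primal_gap -fz => gap0.
have zx : dot (grad f x) (z - x) < 0 by lra.
have := geometric_strong_convexity_le Mx Mz zx sm um.
rewrite /away_step_size; set gA := dot _ _ / dot _ _.
move: zx tz; rewrite !dotBr => zx tz.
have D0 : 0 < dot (grad f x) (val u) - dot (grad f x) (val s) by lra.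
have gAE : dot (grad f x) x - dot (grad f x) z =
    gA * (dot (grad f x) (val u) - dot (grad f x) (val s)).
  by rewrite /gA !dotNl !dotBr; field; lra.
have gA0 : 0 < gA by rewrite -(pmulr_lgt0 _ D0) -gAE; lra.
rewrite mulrAC ler_pdivlMr ?exprn_gt0// => hmu.
set Du := dot _ (val u) - _ in D0 gAE.
set Dv := dot _ (val v) - _.
have DuDv : Du <= Dv by rewrite lerD2r.
have : Du ^+ 2 <= Dv ^+ 2 by rewrite ler_sqr// nnegrE ltW// (lt_le_trans D0).
apply: le_trans.
have : f x - f z <= gA * Du - mu * gA ^+ 2 / 2 by lra.
move=> hle; apply: (@le_trans _ _ (2 * mu * (gA * Du - mu * gA ^+ 2 / 2))).
  by rewrite ler_pM2l ?mulr_gt0.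
rewrite -subr_ge0 [leRHS](_ : _ = (Du - mu * gA) ^+ 2) ?sqr_ge0//.
by field.
Qed.

(* At a vertex the away direction is trivial, so the step size is [1]. *)
Lemma geometric_strong_convexity_le_curvature x :
  conv_hull A x -> 0 < primal_gap f A x -> mu <= C.
Proof.
move=> Mx gap0.
have [alpha wa xE] := Mx.
(* An active atom of largest slope satisfies [f x <= f (val v)], so it is not a minimizer either. *)
have [|v vm] := exists_argmax (grad f x) (V := support_set alpha).
  by have [u au] := is_weight_inh wa; apply/set0Pn; exists u; rewrite finset.inE.
have Mv := conv_hull_val v.
have gv : dot (grad f x) x <= dot (grad f x) (val v).
  rewrite {2}xE; apply: dot_combination_le => // u au; apply: vm.2.
  by rewrite finset.inE.
have fv := convex_ge_tangent (val v) convf (diff_f x).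
have [z [Mz fz _]] := conv_hull_argmin (ex_intro _ x Mx).
have zv := convex_ge_tangent z convf (diff_f (val v)).
move: gap0; rewrite /primal_gap -fz => gap0.
have [|s sm] := exists_argmin (grad f (val v)) (V := [set: A]%SET).
  by apply/set0Pn; exists v; rewrite finset.inE.
have sz := argmin_dot_le sm Mz.
move: fv zv; rewrite !dotBr => fv zv.
have sv0 : dot (grad f (val v)) (val s - val v) < 0 by rewrite dotBr; lra.
(* The singleton of [v] is a support of [val v], and every candidate there has slope at least that
   of [val v]. *)
have vaway : is_away_vertex f (val v) v.
  split=> [|u /away_candidate_ge//].
  exists [set v]%SET; last by split=> [|u]; rewrite finset.inE// => /eqP->.
  exists (vertex_weight v); split; first exact: is_weight_vertex.
    by rewrite combination_vertex_weight.
  exact: support_vertex_weight.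
(* With [z] and the linear minimizer both equal to [val s], the strong convexity quotient is the
   curvature quotient at step size 1. *)
have := geometric_strong_convexity_le Mv (conv_hull_val s) sv0 sm vaway.
have -> : away_step_size f (val v) (val s) (val s) (val v) = 1.
  by rewrite /away_step_size dotNl divff// oppr_eq0 lt_eqF.
have := curvature_le Mv (conv_hull_val s) Mv (gamma := 1).
rewrite ltr01 lexx => /(_ isT); rewrite scale1r addrC subrK.
by rewrite expr1n; lra.
Qed.

End Geometry.

(** * Effect of a weight update *)

Section ReweightedCombination.
Context {R : realType} {d : nat}.
Variable A : {fset 'rV[R]_d}.
Implicit Types (alpha : {ffun A -> R}) (a b : R) (v : A).

(** Covers both updates: [a = 1 - gamma], [b = gamma] for a Frank-Wolfe step and [a = 1 + gamma],
    [b = - gamma] for an away step. *)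
Lemma combination_update alpha a b v :
  combination [ffun u => if u == v then a * alpha u + b else a * alpha u] =
  a *: combination alpha + b *: val v.
Proof.
rewrite /combination (bigD1 v)//= ffunE eqxx scaler_sumr [X in _ = X + _](bigD1 v)//=.
rewrite scalerDl -scalerA addrAC; congr (_ + _ + _).
by apply: eq_bigr => u /negPf uv; rewrite ffunE uv scalerA.
Qed.

Lemma sum_update alpha a b v :
  \sum_u [ffun u => if u == v then a * alpha u + b else a * alpha u] u =
  a * (\sum_u alpha u) + b.
Proof.
rewrite (bigD1 v)//= ffunE eqxx mulr_sumr [X in _ = X + _](bigD1 v)//= addrAC.
by congr (_ + _ + _); apply: eq_bigr => u /negPf uv; rewrite ffunE uv.
Qed.

Lemma weight_le1 alpha v : is_weight alpha -> alpha v <= 1.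
Proof. by move=> [a0 <-]; rewrite (bigD1 v)//= lerDl sumr_ge0. Qed.

Lemma combination_vertex alpha v : is_weight alpha -> alpha v = 1 ->
  combination alpha = val v.
Proof.
move=> [a0 a1] av.
have : \sum_(u | u != v) alpha u = 0.
  by move: a1; rewrite (bigD1 v)//= av => h; lra.
move=> /psumr_eq0P => a0'.
rewrite /combination (bigD1 v)//= av scale1r big1 ?addr0// => u uv.
by rewrite a0' ?scale0r.
Qed.

End ReweightedCombination.

(** * One iteration: validity, descent and number of active atoms *)

Section Step.
Context {R : realType} {d : nat}.
Variables (A : {fset 'rV[R]_d}) (f : 'rV[R]_d -> R) (rules : rafw_rules A).
Hypothesis rulesP : valid_rules f rules.
Implicit Types (st : rafw_state A) (B : {set A}).

Definition valid_state st :=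
  is_weight (weight st) /\ iterate st = combination (weight st).

Definition fw_dir st B := val (fw_atom rules st (active st :|: B)%SET) - iterate st.

Definition away_dir st := iterate st - val (away_atom rules st).

Definition away_max st :=
  weight st (away_atom rules st) / (1 - weight st (away_atom rules st)).

Definition takes_fw st B :=
  dot (- grad f (iterate st)) (away_dir st) <= dot (- grad f (iterate st)) (fw_dir st B).

(** Of the two conditions only [takes_fw] depends on the sample [B]. *)
Definition drops st B :=
  ~~ takes_fw st B && (line_search rules st (away_dir st) (away_max st) == away_max st).

Lemma valid_conv st : valid_state st -> conv_hull A (iterate st).
Proof. by move=> [w ->]; exists (weight st). Qed.

Lemma valid_active st : valid_state st -> active st != finset.set0.
Proof.
move=> [w _]; have [u au] := is_weight_inh w.
by apply/set0Pn; exists u; rewrite finset.inE.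
Qed.

Lemma away_atomP st : valid_state st ->
  is_argmax (grad f (iterate st)) (active st) (away_atom rules st).
Proof. by case: rulesP => _ h _ /valid_active; exact: h. Qed.

Lemma fw_atomP st B : valid_state st ->
  is_argmin (grad f (iterate st)) (active st :|: B)%SET
    (fw_atom rules st (active st :|: B)%SET).
Proof.
case: rulesP => h _ _ /valid_active/set0Pn[u au]; apply: h.
by apply/set0Pn; exists u; rewrite finset.inE au.
Qed.

Lemma fw_atom_le st B : valid_state st ->
  dot (grad f (iterate st)) (val (fw_atom rules st (active st :|: B)%SET)) <=
  dot (grad f (iterate st)) (iterate st).
Proof.
move=> vst; case: (vst) => w {3}->; apply: dot_combination_ge => // u au.
by apply: (fw_atomP B vst).2; rewrite !finset.inE au.
Qed.

Lemma away_atom_ge st : valid_state st ->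
  dot (grad f (iterate st)) (iterate st) <=
  dot (grad f (iterate st)) (val (away_atom rules st)).
Proof.
move=> vst; case: (vst) => w {2}->; apply: dot_combination_le => // u au.
by apply: (away_atomP vst).2; rewrite !finset.inE au.
Qed.

(** A weight of 1 puts the iterate at the away atom, where the away direction vanishes and a
    Frank-Wolfe step is taken; so the denominator of [away_max] is positive at away steps. *)
Lemma away_weight_lt1 st B : valid_state st -> ~~ takes_fw st B ->
  weight st (away_atom rules st) < 1.
Proof.
move=> vst; rewrite /takes_fw -ltNge => lt_fw_away.
rewrite lt_neqAle weight_le1 ?andbT; last exact: vst.1.
apply/eqP => /(combination_vertex vst.1); rewrite -vst.2 => xv.
move: lt_fw_away; rewrite /away_dir -xv /fw_dir !dotNl !dotBr subrr.
by have := fw_atom_le B vst; lra.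
Qed.

Lemma away_max_ge0 st B : valid_state st -> ~~ takes_fw st B -> 0 <= away_max st.
Proof.
move=> vst /(away_weight_lt1 vst) lt1.
by rewrite divr_ge0//; [exact: vst.1.1|rewrite subr_ge0 ltW].
Qed.

Lemma fw_searchP st B (gamma := line_search rules st (fw_dir st B) 1) :
  0 <= gamma <= 1 /\ forall gamma', 0 <= gamma' <= 1 ->
    f (iterate st + gamma *: fw_dir st B) <= f (iterate st + gamma' *: fw_dir st B).
Proof. by case: rulesP => _ _; apply; exact: ler01. Qed.

Lemma away_searchP st B (gamma := line_search rules st (away_dir st) (away_max st)) :
  valid_state st -> ~~ takes_fw st B ->
  0 <= gamma <= away_max st /\ forall gamma', 0 <= gamma' <= away_max st ->
    f (iterate st + gamma *: away_dir st) <= f (iterate st + gamma' *: away_dir st).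
Proof. by case: rulesP => _ _ h vst /(away_max_ge0 vst); apply: h. Qed.

Lemma valid_step st B : valid_state st -> valid_state (rafw_step f rules st B).
Proof.
move=> vst; case: (vst) => [[a0 a1] xE].
rewrite /rafw_step -/(takes_fw st B) -/(fw_dir st B) -/(away_dir st) -/(away_max st).
case: ifPn => [_|nfw].
  have [/andP[g0 g1] _] := fw_searchP st B.
  set gamma := line_search _ _ _ _ in g0 g1 *; split=> /=; last first.
    by rewrite combination_update -xE scalerBr scalerBl scale1r addrCA addrC.
  split=> [u|]; last by rewrite sum_update a1 mulr1 subrK.
  by rewrite ffunE; case: ifP => _; rewrite ?addr_ge0 ?mulr_ge0 ?subr_ge0.
have [/andP[g0 g1] _] := away_searchP vst nfw.
have w1 := away_weight_lt1 vst nfw.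
set gamma := line_search _ _ _ _ in g0 g1 *; split=> /=; last first.
  by rewrite combination_update -xE scalerBr scalerDl scale1r scaleNr addrA.
split=> [u|]; last by rewrite sum_update a1 mulr1 addrK.
rewrite ffunE; case: eqP => [->|_]; last by rewrite mulr_ge0// addr_ge0.
(* The cap [away_max] is exactly what keeps the weight of the away atom nonnegative. *)
by move: g1; rewrite /away_max ler_pdivlMr ?subr_gt0//; lra.
Qed.

Lemma step_le st B : valid_state st ->
  f (iterate (rafw_step f rules st B)) <= f (iterate st).
Proof.
move=> vst.
rewrite /rafw_step -/(takes_fw st B) -/(fw_dir st B) -/(away_dir st) -/(away_max st).
case: ifPn => [_|nfw] /=.
  have [_ /(_ 0)] := fw_searchP st B.
  by rewrite scale0r addr0; apply; rewrite lexx ler01.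
have [_ /(_ 0)] := away_searchP vst nfw.
by rewrite scale0r addr0; apply; rewrite lexx (away_max_ge0 vst nfw).
Qed.

(** Rescaling activates no atom; only the Frank-Wolfe atom can become active. *)
Lemma card_active_step st B : valid_state st ->
  (#|active (rafw_step f rules st B)| <= #|active st|.+1)%N.
Proof.
move=> vst; case: (vst) => [[a0 a1] xE].
rewrite /rafw_step -/(takes_fw st B) -/(fw_dir st B) -/(away_dir st) -/(away_max st).
case: ifPn => [_|nfw].
  have [/andP[g0 g1] _] := fw_searchP st B.
  set s := fw_atom _ _ _.
  apply: (@leq_trans #|s |: active st|%SET); first apply: subset_leq_card.
    apply/fintype.subsetP => u; rewrite !finset.inE /= ffunE; case: eqP => //= _.
    by rewrite ltNge; apply: contraTT; rewrite -!leNgt !negbK => h; nra.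
  by rewrite cardsU1; case: (s \notin _).
apply: (@leq_trans #|active st|) => //; apply: subset_leq_card.
have [/andP[g0 g1] _] := away_searchP vst nfw.
apply/fintype.subsetP => u; rewrite !finset.inE /= ffunE => h.
rewrite lt_neqAle a0 andbT eq_sym; apply/eqP => au.
by move: h; rewrite au mulr0; case: ifP => _; rewrite ?add0r ?oppr_gt0 ltNge ?g0 ?lexx.
Qed.

(** At step size [away_max] the weight of the away atom becomes exactly 0, and rescaling activates
    no other atom. *)
Lemma card_active_drop st B : valid_state st -> drops st B ->
  (#|active (rafw_step f rules st B)| < #|active st|)%N.
Proof.
move=> vst /andP[nfw /eqP gE]; case: (vst) => [[a0 a1] xE].
rewrite /rafw_step -/(takes_fw st B) -/(fw_dir st B) -/(away_dir st) -/(away_max st).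
have w1 := away_weight_lt1 vst nfw.
rewrite (negPf nfw) gE (cardsD1 (away_atom rules st) (active st)).
rewrite (away_atomP vst).1 ltnS; apply: subset_leq_card.
apply/fintype.subsetP => u; rewrite !finset.inE /= ffunE; case: eqP => [->|_] /=.
  rewrite /away_max [X in 0 < X](_ : _ = 0) ?ltxx//.
  by field; rewrite subr_eq0 gt_eqF.
have m0 := away_max_ge0 vst nfw.
by rewrite pmulr_rgt0// ltr_wpDr.
Qed.

(** A full linear minimizer among the candidates gives the largest possible Frank-Wolfe slope, while
    the away slope is the same for every sample. *)
Lemma takes_fw_mono st (s : A) B B' : valid_state st ->
  is_argmin (grad f (iterate st)) [set: A]%SET s -> s \in (active st :|: B')%SET ->
  takes_fw st B -> takes_fw st B'.
Proof.
move=> vst sm sB'; rewrite /takes_fw => /le_trans; apply.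
rewrite /fw_dir !dotNl !dotBr lerN2 lerD2r.
apply: le_trans ((fw_atomP B' vst).2 _ sB') _.
exact/sm.2/finset.in_setT.
Qed.

Lemma drops_mono st (s : A) B B' : valid_state st ->
  is_argmin (grad f (iterate st)) [set: A]%SET s -> s \in (active st :|: B')%SET ->
  drops st B' -> drops st B.
Proof.
move=> vst sm sB' /andP[nfw gE]; rewrite /drops gE andbT.
by apply: contra nfw; exact: takes_fw_mono sB'.
Qed.

(** * Contraction when the linear minimizer is a candidate *)

Section Progress.
Variables (C mu : R).
Hypothesis convf : convex_function (setT : set (convex_lmodType 'rV[R]_d)) f.
Hypothesis diff_f : forall x, differentiable f x.
Hypothesis curvf : away_curvature f A = C%:E.
Hypothesis geomf : geometric_strong_convexity f A = mu%:E.
Hypotheses (C_gt0 : 0 < C) (mu_gt0 : 0 < mu).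

(* Along a convex function, a line search that stops before the end of the
   interval is optimal beyond it too. *)
Lemma away_search_global st B
    (gamma := line_search rules st (away_dir st) (away_max st)) :
  valid_state st -> ~~ takes_fw st B -> ~~ drops st B ->
  forall gamma', 0 <= gamma' ->
    f (iterate st + gamma *: away_dir st) <= f (iterate st + gamma' *: away_dir st).
Proof.
move=> vst nfw; rewrite /drops nfw /= => gmax gamma' g'0.
have [/andP[g0 gle] gmin] := away_searchP vst nfw.
have [g'le|ltg'] := leP gamma' (away_max st); first by apply: gmin; rewrite g'0.
have {gle} gmax : gamma < away_max st by rewrite lt_neqAle gmax.
set x := iterate st; set w := away_dir st.
(* The end of the interval lies at fraction [t] of the way from [gamma] to [gamma']; by convexity a
   smaller value at [gamma'] would give one at that end. *)
pose t := (away_max st - gamma) / (gamma' - gamma).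
have g'g : 0 < gamma' - gamma by rewrite subr_gt0 (lt_trans gmax).
have t0 : 0 < t by rewrite divr_gt0// subr_gt0.
have t1 : t <= 1 by rewrite ler_pdivrMr// mul1r lerD2r ltW.
have := @convex_segment _ _ f (x + gamma *: w) (x + gamma' *: w) t convf.
rewrite (ltW t0) t1 => /(_ isT).
have -> : x + gamma *: w + t *: (x + gamma' *: w - (x + gamma *: w)) =
    x + away_max st *: w.
  rewrite opprD addrACA subrr add0r -scalerBl scalerA -addrA -scalerDl.
  by congr (_ + _ *: _); rewrite /t divfK ?gt_eqF// addrC subrK.
have := gmin (away_max st); rewrite lexx (le_trans g0 (ltW gmax)) => /(_ isT).
rewrite -/x -/w -/gamma => h1 h2.
by rewrite -subr_ge0 -(pmulr_rge0 _ t0); lra.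
Qed.

Lemma good_step st (s : A) B : valid_state st -> 0 < primal_gap f A (iterate st) ->
  is_argmin (grad f (iterate st)) [set: A]%SET s -> s \in (active st :|: B)%SET ->
  ~~ drops st B ->
  primal_gap f A (iterate (rafw_step f rules st B)) <=
    (1 - mu / (4 * C)) * primal_gap f A (iterate st).
Proof.
move=> vst gap0 sm sB ndrop; have Mx := valid_conv vst.
have muC := geometric_strong_convexity_le_curvature convf diff_f curvf geomf Mx gap0.
set h := primal_gap f A (iterate st) in gap0 *.
set v := away_atom rules st; set g := grad f (iterate st).
set y := iterate _.
suff : f y <= f (iterate st) - mu / (4 * C) * h.
  by rewrite mulrBl mul1r {2}/h /primal_gap; lra.
have hD : 2 * mu * h <= dot g (val v - val s) ^+ 2.
  have [wst xE] := vst.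
  have := @primal_gap_le_pairwise _ _ A f mu convf diff_f geomf mu_gt0 (weight st) s v wst.
  by rewrite -xE; apply => //; exact: away_atomP.
have hs : h <= dot g (iterate st - val s) by exact: primal_gap_le_dot.
have vx := away_atom_ge vst.
have ss : dot g (val (fw_atom rules st (active st :|: B)%SET)) = dot g (val s).
  apply/eqP; rewrite eq_le (fw_atomP B vst).2//= sm.2//; exact: finset.in_setT.
rewrite -/g -/v in vx; rewrite dotBr in hs.
have D0 : 0 <= dot g (val v - val s) by rewrite dotBr; lra.
rewrite /y /rafw_step -/(takes_fw st B) -/(fw_dir st B) -/(away_dir st) -/(away_max st).
(* The Frank-Wolfe and away slopes add up to the pairwise gap, so the larger one is at least half of
   it. *)
have [fw|nfw] := boolP (takes_fw st B) => /=.
  apply: (@quadratic_descent _ C mu (dot g (iterate st - val s)) _ _ _ _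
    C_gt0 mu_gt0 muC D0 _ gap0 _ hD); rewrite ?dotBr//.
    move: fw; rewrite /takes_fw /away_dir /fw_dir -/g -/v !dotNl !dotBr ss; lra.
  move=> gamma /[dup] /andP[g0 g1] g01.
  have [_ /(_ gamma)] := fw_searchP st B; rewrite (ltW g0) g1 => /(_ isT) hle.
  apply: (le_trans hle).
  apply: le_trans (curvature_le curvf Mx (conv_hull_val _) Mx g01) _.
  by rewrite -/g dotBr ss; lra.
move: (nfw); rewrite /takes_fw -ltNge /away_dir /fw_dir -/g -/v !dotNl !dotBr ss => lt_fw.
apply: (@quadratic_descent _ C mu (dot g (val v) - dot g (iterate st)) _ _ _ _
    C_gt0 mu_gt0 muC D0 _ gap0 _ hD); rewrite ?dotBr; [lra|lra|].
move=> gamma /[dup] /andP[g0 g1] g01.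
(* The comparison runs over all step sizes up to 1, even past [away_max], where the point may leave
   the hull; the away curvature constant covers such points. *)
apply: le_trans (away_search_global vst nfw ndrop (ltW g0)) _.
apply: le_trans (curvature_le curvf Mx Mx (conv_hull_val _) g01) _.
by rewrite -/g -/v dotBr; lra.
Qed.

End Progress.
End Step.

(** * Counting the samples *)

Lemma card_samples {R : realType} {d : nat} (A : {fset 'rV[R]_d}) p (S : {set A}) :
  #|samples p S| = 'C(#|~: S|, minn p #|~: S|).
Proof.
by rewrite -cards_draws; apply: eq_card => B; rewrite !finset.inE.
Qed.

Lemma card_samples_gt0 {R : realType} {d : nat} (A : {fset 'rV[R]_d}) p (S : {set A}) :
  (0 < #|samples p S|)%N.
Proof. by rewrite card_samples bin_gt0 geq_minr. Qed.

(** ['C(n, m) - 'C(n.-1, m)] counts the [m]-subsets of an [n]-set through a fixed element, a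
    fraction [m / n] of all; and [p * n <= a * m] whichever term attains the minimum. *)
Lemma bin_ratio (n p a : nat) (m := minn p n) :
  (0 < n <= a)%N -> (0 < p <= a)%N ->
  (p * 'C(n, m) <= a * ('C(n, m) - 'C(n.-1, m)))%N.
Proof.
move=> /andP[n0 na] /andP[p0 pa].
have mE : (p * n <= a * m)%N.
  by rewrite /m /minn; case: ltnP => _; [rewrite mulnC|]; rewrite leq_mul.
have m0 : (0 < m)%N by rewrite leq_min p0 n0.
clearbody m; case: n m m0 n0 na mE => [//|n] [//|m] _ _ na mE /=.
rewrite [in leqRHS]binS addKn -(leq_pmul2l (ltn0Sn n)).
have -> : (n.+1 * (a * 'C(n, m)) = a * m.+1 * 'C(n.+1, m.+1))%N.
  by rewrite mulnCA mul_bin_diag mulnA.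
by rewrite mulnA [(n.+1 * p)%N]mulnC leq_mul.
Qed.

(** The lower bound eta on the probability that [s] is a candidate, with denominators cleared;
    outside [S] it is counted through the samples that miss [s]. *)
Lemma card_samples_hit {R : realType} {d : nat} (A : {fset 'rV[R]_d}) p
    (S : {set A}) (s : A) :
  (1 <= p <= #|` A|)%N ->
  (p * #|samples p S| <= #|` A| * #|[set B in samples p S | s \in S :|: B]%SET|)%N.
Proof.
move=> pA; have [sS|sS] := boolP (s \in S).
  rewrite (_ : [set B in _ | _]%SET = samples p S) ?leq_mul//; first by case/andP: pA.
  by apply/setP => B; rewrite !finset.inE sS andbT.
have nA : (0 < #|~: S| <= #|` A|)%N.
  rewrite cardfE max_card andbT.
  by apply/card_gt0P; exists s; rewrite finset.inE.
have miss : #|[set B in samples p S | s \notin S :|: B]%SET| =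
    'C(#|~: S|.-1, minn p #|~: S|).
  have -> : #|~: S|.-1 = #|(~: S) :\ s|%SET.
    by rewrite [in LHS](cardsD1 s) finset.inE sS.
  rewrite -cards_draws; apply: eq_card => B; rewrite !finset.inE (negPf sS) /=.
  by rewrite subsetD1 andbAC.
have := cardsID [set B : {set A} | s \in S :|: B]%SET (samples p S).
rewrite (_ : (_ :&: _)%SET = [set B in samples p S | s \in S :|: B]%SET); last first.
  by apply/setP => B; rewrite !finset.inE.
rewrite (_ : (_ :\: _)%SET = [set B in samples p S | s \notin S :|: B]%SET); last first.
  by apply/setP => B; rewrite !finset.inE andbC.
rewrite miss => cE; have := bin_ratio nA pA.
by rewrite -card_samples -cE addnK.
Qed.

(** * Averaging one iteration over the samples *)

Section ExpectedStep.
Context {R : realType} {d : nat}.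
Variables (A : {fset 'rV[R]_d}) (f : 'rV[R]_d -> R) (rules : rafw_rules A).
Variables (C mu : R) (p : nat).
Hypothesis rulesP : valid_rules f rules.
Hypothesis convf : convex_function (setT : set (convex_lmodType 'rV[R]_d)) f.
Hypothesis diff_f : forall x, differentiable f x.
Hypothesis curvf : away_curvature f A = C%:E.
Hypothesis geomf : geometric_strong_convexity f A = mu%:E.
Hypotheses (C_gt0 : 0 < C) (mu_gt0 : 0 < mu) (mu_le_C : mu <= C).
Hypothesis p_bounds : (1 <= p <= #|` A|)%N.

Let rho := mu / (4 * C).
Let eta := p%:R / #|` A|%:R : R.
Let r := 1 - eta ^+ 2 * rho.

Let cardA_gt0 : 0 < #|` A|%:R :> R.
Proof. by rewrite ltr0n; case/andP: p_bounds => p0; exact: leq_trans. Qed.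

Let rho_ge0 : 0 <= rho.
Proof. by rewrite divr_ge0 ?mulr_ge0 ?ltW. Qed.

Let rho_le1 : rho <= 1.
Proof. by rewrite ler_pdivrMr ?mulr_gt0//; move: C_gt0 mu_le_C; lra. Qed.

Let eta_ge0 : 0 <= eta.
Proof. by rewrite divr_ge0. Qed.

Let eta_le1 : eta <= 1.
Proof. by rewrite ler_pdivrMr// mul1r ler_nat; case/andP: p_bounds. Qed.

Let r_ge0 : 0 <= r.
Proof. by rewrite subr_ge0 mulr_ile1 ?exprn_ile1 ?exprn_ge0. Qed.

Let r_le1 : r <= 1.
Proof. by rewrite gerBl mulr_ge0 ?exprn_ge0. Qed.

Let r_exp_le (m n : nat) : (n <= m)%N -> r ^+ m <= r ^+ n.
Proof. by move=> nm; apply: ler_wiXn2l; rewrite ?r_ge0 ?r_le1. Qed.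

(* With [n] iterations left, [(n - k.+1)./2] of them are guaranteed to be
   productive when [k] atoms are active: a drop step costs an iteration but
   removes an atom, any other step is productive and adds at most one atom. *)
Lemma expected_step_le (st : rafw_state A) n : valid_state st ->
  \sum_(B in samples p (active st))
    r ^+ (n - #|active (rafw_step f rules st B)|.+1)./2 *
    primal_gap f A (iterate (rafw_step f rules st B)) <=
  #|samples p (active st)|%:R *
    (r ^+ (n.+1 - #|active st|.+1)./2 * primal_gap f A (iterate st)).
Proof.
move=> vst; set adm := samples _ _; set k := #|active st|.
set h := primal_gap f A (iterate st).
have step_ge0 B : 0 <= primal_gap f A (iterate (rafw_step f rules st B)).
  by apply: primal_gap_ge0 => //; apply: valid_conv; exact: valid_step.
have step_h B : primal_gap f A (iterate (rafw_step f rules st B)) <= h.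
  by rewrite lerD2r step_le.
have h_ge0 : 0 <= h := le_trans (step_ge0 finset.set0) (step_h _).
(* A drop step pays for its iteration with an atom, so the exponent does not decrease and a
   nonincreasing gap suffices. *)
have exp_drop B : drops f rules st B ->
    r ^+ (n - #|active (rafw_step f rules st B)|.+1)./2 *
    primal_gap f A (iterate (rafw_step f rules st B)) <=
    r ^+ (n.+1 - k.+1)./2 * h.
  move=> dr; rewrite ler_pM ?exprn_ge0// r_exp_le//.
  by rewrite half_leq// subSS leq_sub2l// card_active_drop.
rewrite mulr_natl -sumr_const.
have [all_drop|/forallPn[B0 ndrop0]] := boolP [forall B, drops f rules st B].
  by apply: ler_sum => B _; exact/exp_drop/forallP.
(* [good_step] needs a positive gap; a zero gap stays zero. *)
move: (h_ge0); rewrite le_eqVlt => /predU1P[h0|h_gt0].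
  apply: ler_sum => B _; rewrite -h0 mulr0.
  have -> : primal_gap f A (iterate (rafw_step f rules st B)) = 0.
    by apply/eqP; rewrite eq_le step_ge0 h0 step_h.
  by rewrite mulr0.
have [s sm] : exists s, is_argmin (grad f (iterate st)) [set: A]%SET s.
  apply: exists_argmin; case/set0Pn: (valid_active vst) => u _.
  by apply/set0Pn; exists u; rewrite finset.inE.
(* The single sample [B0] rules out a drop for every sample that offers [s]. *)
have hit_good B : s \in (active st :|: B)%SET -> ~~ drops f rules st B.
  by move=> sB; apply: contra ndrop0; exact: drops_mono sB.
(* The exponent left if the step adds an atom. *)
pose e := (n - k.+2)./2.
have exp_nondrop B : ~~ drops f rules st B ->
    r ^+ (n - #|active (rafw_step f rules st B)|.+1)./2 *
    primal_gap f A (iterate (rafw_step f rules st B)) <=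
    r ^+ e * (h - rho * h * (s \in (active st :|: B)%SET)%:R).
  move=> ndr; rewrite ler_pM ?exprn_ge0//.
    by rewrite r_exp_le// half_leq// leq_sub2l// ltnS card_active_step.
  have [sB|_] := boolP (s \in _); last by rewrite mulr0 subr0.
  rewrite mulr1 -{1}(mul1r h) -mulrBl.
  exact: good_step sB ndr.
rewrite (bigID (drops f rules st)) [leRHS](bigID (drops f rules st)) /=.
apply: lerD; first by apply: ler_sum => B /andP[_]; exact: exp_drop.
apply: (@le_trans _ _ (\sum_(B in adm | ~~ drops f rules st B)
    r ^+ e * (h - rho * h * (s \in (active st :|: B)%SET)%:R))).
  by apply: ler_sum => B /andP[_]; exact: exp_nondrop.
rewrite -mulr_sumr sumrB -mulr_sumr sumr_const -natr_sum.
set D := (\sum_(B in adm | _) _)%N.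
(* Since no hit drops, the hits among the non-drop samples are all the hits. *)
have hitD : D = #|[set B in adm | s \in active st :|: B]%SET|.
  rewrite /D -sum1_card big_mkcond [RHS]big_mkcond /=; apply: eq_bigr => B _.
  have -> : B \in [set B in adm | s \in active st :|: B]%SET =
      (B \in adm) && (s \in active st :|: B)%SET by exact: finset.in_set.
  case: (B \in adm) => //=; case: ifPn => [_|]; first by case: (s \in _).
  by rewrite negbK; case: ifP => // /hit_good /negPf->.
rewrite sumr_const; set N := #|_|.
have Nadm : (N <= #|adm|)%N by apply: subset_leq_card; apply/fintype.subsetP => B /andP[].
(* Conditioning on no drop removes only misses, so the proportion of hits stays at least [eta]. *)
have etaN : eta * N%:R <= D%:R.
  rewrite mulrAC ler_pdivrMr// -!natrM ler_nat hitD [leqRHS]mulnC.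
  apply: leq_trans (card_samples_hit (active st) s p_bounds).
  by rewrite leq_mul.
(* [e.+1] equals [(n - k)./2] when [n - k] is at least 2; otherwise truncated subtraction makes it
   larger. *)
apply: (@le_trans _ _ (r ^+ e.+1 * h * N%:R)); last first.
  rewrite -[leRHS]mulr_natr ler_wpM2r// ler_wpM2r// r_exp_le//.
  by rewrite /e subSS 2!subnS; case: (n - k)%N => [|[]].
have -> : r ^+ e * (h *+ N - rho * h * D%:R) = r ^+ e * h * (N%:R - rho * D%:R).
  by rewrite -[h *+ N]mulr_natr -(mulrA rho) [rho * (h * _)]mulrCA -mulrBr mulrA.
have -> : r ^+ e.+1 * h * N%:R = r ^+ e * h * (r * N%:R) 
  by rewrite exprSr -!mulrA (mulrCA r).
rewrite ler_wpM2l ?mulr_ge0 ?exprn_ge0// /r mulrBl mul1r lerD2l lerN2.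
(* The averaging yields the factor [1 - eta * rho]; [eta <= 1] weakens it to [r]. *)
have -> : eta ^+ 2 * rho * N%:R = rho * (eta * (eta * N%:R)).
  by rewrite [eta ^+ 2 * rho]mulrC expr2 -!mulrA.
by rewrite ler_wpM2l// (le_trans _ etaN)// ler_piMl// mulr_ge0.
Qed.

End ExpectedStep.

(** * Cylinder events of the sampling process *)

Section Prefix.
Context {disp : measure_display} {Omega : measurableType disp} {T : finType}.
Variable X : nat -> Omega -> T.
Implicit Types (t : nat) (B : nat -> T).

Definition prefix_event t B := [set w | forall i, (i < t)%N -> X i w = B i].

Definition extend t B (b : T) := fun i => if i == t then b else B i.

Lemma prefix_event0 B : prefix_event 0 B = setT.
Proof. by apply/seteqP; split. Qed.

Lemma prefix_eventS t B :
  prefix_event t.+1 B = prefix_event t B `&` [set w | X t w = B t].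
Proof.
apply/seteqP; split=> w /= => [h|[h hB] i].
  by split=> [i it|]; apply: h => //; exact: ltnW.
by rewrite ltnS leq_eqVlt => /predU1P[->//|]; exact: h.
Qed.

Lemma extend_at t B b : extend t B b t = b.
Proof. by rewrite /extend eqxx. Qed.

Lemma extend_before t B b i : (i < t)%N -> extend t B b i = B i.
Proof. by move=> it; rewrite /extend ltn_eqF. Qed.

Lemma eq_prefix_event t B B' : (forall i, (i < t)%N -> B i = B' i) ->
  prefix_event t B = prefix_event t B'.
Proof.
by move=> BB'; apply/seteqP; split=> w h i it; rewrite h// BB'.
Qed.

Lemma prefix_event_extend t B b :
  prefix_event t.+1 (extend t B b) = prefix_event t B `&` [set w | X t w = b].
Proof.
rewrite prefix_eventS extend_at (@eq_prefix_event _ _ B)//.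
exact: extend_before.
Qed.

Hypothesis mX : forall t b, measurable [set w | X t w = b].

Lemma measurable_prefix_event t B : measurable (prefix_event t B).
Proof.
elim: t => [|t IH]; first by rewrite prefix_event0.
by rewrite prefix_eventS; apply: measurableI.
Qed.

Lemma trivIset_extend t B :
  trivIset [set` index_enum T] (fun b => prefix_event t.+1 (extend t B b)).
Proof.
move=> b b' _ _ [w [] ]; rewrite !prefix_event_extend => -[_ <-] [_ <-] //.
Qed.

Lemma prefix_event_split t B :
  prefix_event t B = \big[setU/set0]_(b : T) prefix_event t.+1 (extend t B b).
Proof.
rewrite -bigcup_seq; apply/seteqP; split=> w.
  by move=> wB; exists (X t w); rewrite /= ?mem_index_enum// prefix_event_extend.
by move=> [b _]; rewrite prefix_event_extend => -[].
Qed.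

(** The next sample splits the cylinder into finitely many measurable pieces, so measurability
    reduces to longer cylinders. *)
Lemma measurable_fun_extend {d' : measure_display} {Y : measurableType d'}
    (g : Omega -> Y) t B :
  (forall b, measurable_fun (prefix_event t.+1 (extend t B b)) g) ->
  measurable_fun (prefix_event t B) g.
Proof.
move=> mg; rewrite prefix_event_split.
elim: (index_enum T) => [|b bs IH]; first by rewrite big_nil; exact: measurable_fun_set0.
rewrite big_cons; apply/measurable_funU => //; first exact: measurable_prefix_event.
by apply: bigsetU_measurable => b' _; exact: measurable_prefix_event.
Qed.

End Prefix.

(** * Backward induction over the remaining iterations *)

Section Sampling.
Context {R : realType} {d : nat}.
Variables (A : {fset 'rV[R]_d}) (f : 'rV[R]_d -> R) (rules : rafw_rules A).
Variables (alpha0 : {ffun A -> R}).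

Lemma rafw_eq_prefix (B B' : nat -> {set A}) t : (forall i, (i < t)%N -> B i = B' i) ->
  rafw f rules alpha0 B t = rafw f rules alpha0 B' t.
Proof.
elim: t => //= t IH BB'; rewrite BB'// IH// => i it.
by apply: BB'; exact: ltnW.
Qed.

Lemma rafw_extend (B : nat -> {set A}) t b :
  rafw f rules alpha0 (extend t B b) t.+1 = rafw_step f rules (rafw f rules alpha0 B t) b.
Proof.
rewrite /= extend_at; congr rafw_step.
by apply: rafw_eq_prefix => i; exact: extend_before.
Qed.

Lemma valid_rafw (B : nat -> {set A}) t : valid_rules f rules -> is_weight alpha0 ->
  valid_state (rafw f rules alpha0 B t).
Proof. by move=> rulesP w0; elim: t => //= t IH; exact: valid_step. Qed.

Variables (C mu : R) (p : nat).
Variables (disp : measure_display) (Omega : measurableType disp).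
Variables (P : probability Omega R) (As : nat -> Omega -> {set A}).
Hypothesis rulesP : valid_rules f rules.
Hypothesis w0 : is_weight alpha0.
Hypothesis convf : convex_function (setT : set (convex_lmodType 'rV[R]_d)) f.
Hypothesis diff_f : forall x, differentiable f x.
Hypothesis curvf : away_curvature f A = C%:E.
Hypothesis geomf : geometric_strong_convexity f A = mu%:E.
Hypotheses (C_gt0 : 0 < C) (mu_gt0 : 0 < mu) (mu_le_C : mu <= C).
Hypothesis p_bounds : (1 <= p <= #|` A|)%N.
Hypothesis unif : uniform_sampling f rules alpha0 p P As.

Let r := 1 - (p%:R / #|` A|%:R) ^+ 2 * (mu / (4 * C)).
Let gap t w := primal_gap f A (iterate (rafw f rules alpha0 (fun i => As i w) t)).

Let mAs : forall t b, measurable [set w | As t w = b].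
Proof. exact: unif.1. Qed.

Lemma prob_extend t B b : P (prefix_event As t.+1 (extend t B b)) =
  (P (prefix_event As t B) *
    ((b \in samples p (active (rafw f rules alpha0 B t)))%:R /
      #|samples p (active (rafw f rules alpha0 B t))|%:R)%:E)%E.
Proof.
rewrite [LHS](unif.2 t (extend t B b)) extend_at.
rewrite (@rafw_eq_prefix _ B) => [|i]; last exact: extend_before.
by rewrite [X in P X](@eq_prefix_event _ _ _ As t _ B) => [|i]; last exact: extend_before.
Qed.

(** Induction on the number [n] of remaining iterations, for all cylinders: the state before
    iteration [t] is constant on a cylinder, and splitting by the next sample reduces to
    [expected_step_le]. Measurability is carried along because splitting the integral requires
    it. *)
Lemma gap_on_prefix t n B :
  measurable_fun (prefix_event As t B) (gap (n + t)) /\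
  (\int[P]_(w in prefix_event As t B) (gap (n + t) w)%:E <=
    P (prefix_event As t B) *
    (r ^+ (n - #|active (rafw f rules alpha0 B t)|.+1)./2 *
      primal_gap f A (iterate (rafw f rules alpha0 B t)))%:E)%E.
Proof.
elim: n t B => [|n IH] t B.
  have gapE : {in prefix_event As t B,
      cst (primal_gap f A (iterate (rafw f rules alpha0 B t))) =1 gap (0 + t)}.
    move=> w; rewrite inE => wB; congr (primal_gap f A (iterate _)).
    by apply: rafw_eq_prefix => i it; rewrite wB.
  split; first by apply: eq_measurable_fun gapE _; exact: measurable_cst.
  rewrite (eq_integral (cst (primal_gap f A (iterate (rafw f rules alpha0 B t)))%:E)).
    rewrite integral_cst; last exact: measurable_prefix_event.
    by rewrite sub0n expr0 mul1r muleC.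
  by move=> w /gapE /= <-.
have mgap : measurable_fun (prefix_event As t B) (gap (n.+1 + t)).
  by apply: measurable_fun_extend => // b; rewrite addSnnS; exact: (IH t.+1 _).1.
split=> //; move: mgap; rewrite {1 2}(prefix_event_split As t B) => mgap.
rewrite integral_bigsetU_EFin//=; last first.
- exact/measurable_realfun.measurable_EFinP.
- exact: trivIset_extend.
- exact: index_enum_uniq.
- by move=> b; exact: measurable_prefix_event.
set st := rafw f rules alpha0 B t.
have vst : valid_state st by exact: valid_rafw.
have Pfin : P (prefix_event As t B) \is a fin_num.
  by rewrite fin_num_measure//; exact: measurable_prefix_event.
apply: (@le_trans _ _ (\sum_(b : {set A}) P (prefix_event As t B) *
    ((b \in samples p (active st))%:R / #|samples p (active st)|%:R *
     (r ^+ (n - #|active (rafw_step f rules st b)|.+1)./2 *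
      primal_gap f A (iterate (rafw_step f rules st b))))%:E)%E).
  apply: lee_sum => b _; rewrite addSnnS.
  apply: le_trans (IH t.+1 (extend t B b)).2 _.
  by rewrite prob_extend rafw_extend -muleA -EFinM.
rewrite -(fineK Pfin); under eq_bigr do rewrite -EFinM.
rewrite sumEFin -EFinM lee_fin -mulr_sumr ler_wpM2l ?fine_ge0//.
under eq_bigr do rewrite mulrAC.
rewrite -mulr_suml ler_pdivrMr ?ltr0n ?card_samples_gt0// [leRHS]mulrC.
apply: le_trans (expected_step_le rulesP convf diff_f curvf geomf
  C_gt0 mu_gt0 mu_le_C p_bounds n vst).
rewrite [leRHS]big_mkcond; apply: ler_sum => b _.
by case: ifP => _; rewrite ?mul1r ?mul0r.
Qed.

End Sampling.

(* [(T - s)./2] is natural number arithmetic: it is max{0, floor((T - s) / 2)}. *)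
Theorem theorem3p1 (R : realType) (d : nat) (A : {fset 'rV[R]_d})
    (f : 'rV[R]_d -> R) (CfA mufA : R) (p : nat)
    (rules : rafw_rules A) (alpha0 : {ffun A -> R})
    (disp : measure_display) (Omega : measurableType disp)
    (P : probability Omega R) (As : nat -> Omega -> {set A}) :
  (forall v, v \in A -> extreme_point (conv_hull A) v) ->
  convex_function (setT : set (convex_lmodType 'rV[R]_d)) f ->
  (forall x, differentiable f x) ->
  away_curvature f A = CfA%:E -> 0 < CfA ->
  geometric_strong_convexity f A = mufA%:E -> 0 < mufA ->
  (1 <= p <= #|` A|)%N ->
  valid_rules f rules ->
  is_weight alpha0 ->
  uniform_sampling f rules alpha0 p P As ->
  let rho := mufA / (4 * CfA) in
  let eta := p%:R / #|` A|%:R in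
  let s := #|support_set alpha0| in
  let x0 := combination alpha0 in
  let x t w := iterate (rafw f rules alpha0 (fun i => As i w) t) in
  forall T : nat,
    ('E_P[fun w => primal_gap f A (x T.+1 w)]
      <= ((1 - eta ^+ 2 * rho) ^+ (T - s)./2 * primal_gap f A x0)%:E)%E.
Proof.
move=> _ convf diff_f curvf C0 geomf mu0 p_bounds rulesP w0 unif rho eta s x0 x T.
have Mx0 : conv_hull A x0 by exists alpha0.
rewrite unlock.
(* A zero initial gap is kept by descent; it is treated apart because [mufA <= CfA] is derived from
   a positive gap. *)
have := primal_gap_ge0 diff_f Mx0; rewrite le_eqVlt => /predU1P[gap0|gap0].
  rewrite -gap0 mulr0 integral0_eq// => w _; congr (_%:E).
  have vx t : valid_state (rafw f rules alpha0 (fun i => As i w) t).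
    exact: valid_rafw.
  apply/eqP; rewrite eq_le primal_gap_ge0 ?andbT//; last exact: valid_conv.
  rewrite gap0; elim: T.+1 => // t; apply: le_trans.
  by rewrite lerD2r step_le.
have mu_le_C := geometric_strong_convexity_le_curvature convf diff_f curvf geomf Mx0 gap0.
(* The empty prefix is the whole space, so any sequence serves as [B]; with [T.+1] iterations to
   run, [T.+1 - s.+1] is [T - s]. *)
have [_] := gap_on_prefix rulesP w0 convf diff_f curvf geomf C0 mu0 mu_le_C
  p_bounds unif 0 T.+1 (fun=> finset.set0).
by rewrite prefix_event0 probability_setT mul1e addn0 subSS.
Qed.
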